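(* Let $X$ be an irreducible continuum. Then $NWC_1(X)=CC_1(X)$.
   Context: All spaces are metric; a continuum is a compact connected space with more than one point. For a non-empty space $Y$: $2^Y$ is the set of non-empty compact subsets of $Y$; the subcontinua of $Y$ are the non-empty compact connected subsets of $Y$. A continuum $X$ is irreducible if there exist $p,q\in X$ such that no proper subcontinuum of $X$ contains $\{p,q\}$. A non-empty space $Y$ is: - $1$-$Q1$ if there exists a one-point set $B\subset Y$ such that for each $x\in Y$ there exists a continuum $D\subset Y$ with $x\in \mathrm{int}_Y(D)$ and $B\cap D\neq\emptyset$; - $1$-$Q2$ if there exists a one-point set $B\subset Y$ such that for each $x\in Y$ there exists a continuum $D\subset Y$ with $x\in D$ and $B\cap D\neq\emptyset$. For a continuum $X$: $CC_1(X)=\{A\in 2^X: A=X$ or $X-A$ is $1$-$Q1\}$; $NWC_1(X)=\{A\in 2^X: A=X$ or $X-A$ is $1$-$Q2\}$. *)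

(* Defs.v *)
From mathcomp Require Import all_boot all_order all_algebra.
From mathcomp Require Import all_classical all_reals all_analysis.

Set Implicit Arguments.
Unset Strict Implicit.
Unset Printing Implicit Defensive.

Local Open Scope classical_set_scope.

(* Spaces are given as subsets, with the induced topology, of an ambient
   topological space; the whole space T is [set: T]. Compactness and
   connectedness do not depend on the ambient space. *)

Definition continuum (T : topologicalType) (D : set T) : Prop :=
  [/\ compact D, connected D & exists x y, [/\ D x, D y & x <> y]].

(* Unlike a continuum, a subcontinuum may be a single point. *)
Definition subcontinuum (T : topologicalType) (Y D : set T) : Prop :=
  [/\ D `<=` Y, D !=set0, compact D & connected D].

Definition irreducible (T : topologicalType) : Prop :=
  exists p q : T, ~ exists D : set T,
    [/\ subcontinuum [set: T] D, D <> [set: T] & [set p; q] `<=` D].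

(* Hyperspace 2^Y of non-empty compact subsets. *)
Definition hyperspace (T : topologicalType) (Y : set T) : set (set T) :=
  [set A | [/\ A `<=` Y, A !=set0 & compact A]].

(* Interior of D relative to Y, for D `<=` Y. The points outside Y are isolated
   in [subspace Y], so they do not contribute when D `<=` Y. *)
Definition rel_interior (T : topologicalType) (Y D : set T) : set T :=
  @interior (subspace Y) D.

Definition is_1Q1 (T : topologicalType) (Y : set T) : Prop :=
  exists B : set T, [/\ B `<=` Y, exists b, B = [set b] &
    forall x, Y x -> exists D : set T,
      [/\ continuum D, D `<=` Y, rel_interior Y D x & B `&` D !=set0]].

Definition is_1Q2 (T : topologicalType) (Y : set T) : Prop :=
  exists B : set T, [/\ B `<=` Y, exists b, B = [set b] &
    forall x, Y x -> exists D : set T,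
      [/\ continuum D, D `<=` Y, D x & B `&` D !=set0]].

Definition CC1 (T : topologicalType) : set (set T) :=
  [set A | hyperspace [set: T] A /\ (A = [set: T] \/ is_1Q1 (~` A))].

Definition NWC1 (T : topologicalType) : set (set T) :=
  [set A | hyperspace [set: T] A /\ (A = [set: T] \/ is_1Q2 (~` A))].

Arguments CC1 T : clear implicits.
Arguments NWC1 T : clear implicits.

(* Main.v *)
Require Import Defs.
From mathcomp Require Import all_boot all_order all_algebra.
From mathcomp Require Import all_classical all_reals all_analysis.

(** Only the inclusion of [NWC1 X] in [CC1 X] has content.  Let [U] be the
    complement of a member of [NWC1 X] other than the whole space: [U] is open,
    and all its points are joined to a base point [b] by continua inside [U].
    One has to find, around each point [x] of [U], such a continuum that is a
    neighbourhood of [x].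

    Let [p] and [q] be points between which [X] is irreducible, and let [V] be
    an open neighbourhood of [x] with closure inside [U].  If [p] lies outside
    [V], the quasi-component [C] of [p] in the complement of [V] reaches the
    closure of [V] (boundary bumping), hence it meets [U], and some continuum
    [D] inside [U] joins a point of [C] to [b].  So [E = C `|` D] is a continuum
    from [p] to [b] which enters [V] only along [D]; if [p] lies in [V], then
    [D] joining [p] to [b] can serve as [E] itself ([approach_through_open]).
    Doing the same with [q] gives [D'] and [E'].  The union of [E] and [E'] is
    connected through [b] and contains [p] and [q], so by irreducibility it is
    the whole of [X].  In particular it covers [V], whence [V] is contained in
    [D `|` D'].  This last union is a continuum in [U] that contains [b] and has
    [x] in its interior ([irreducible_join_nbhs]).

    Boundary bumping itself holds because in a compact Hausdorff space the
    intersection of all relatively clopen sets around [p] is connected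
    ([quasi_component_connected]): if it missed the closure of [V], one of those
    clopen sets would miss it too, and would be clopen in the whole connected
    space. *)

Local Open Scope classical_set_scope.

(** * Quasi-components and boundary bumping *)

(** Relative clopenness in [K] is expressed by closed sets of the ambient
    space, which is equivalent when [K] is closed. *)
Definition relative_clopens {T : topologicalType} (K : set T) (p : T) :
    set (set T) :=
  [set W | [/\ W `<=` K, closed W, closed (K `\` W) & W p]].

Definition quasi_component {T : topologicalType} (K : set T) (p : T) : set T :=
  \bigcap_(W in relative_clopens K p) W.

Lemma relative_clopensT {T : topologicalType} (K : set T) (p : T) :
  closed K -> K p -> relative_clopens K p K.
Proof. by move=> cK Kp; split=> //; rewrite setDv; exact: closed0. Qed.

Lemma relative_clopensI {T : topologicalType} (K : set T) (p : T)
    (W W' : set T) :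
  relative_clopens K p W -> relative_clopens K p W' ->
  relative_clopens K p (W `&` W').
Proof.
move=> [WK cW cKW Wp] [_ cW' cKW' W'p]; split=> //.
- by move=> y [/WK].
- exact: closedI.
- by rewrite setDIr; exact: closedU.
Qed.

Lemma quasi_component_closed {T : topologicalType} (K : set T) (p : T) :
  closed (quasi_component K p).
Proof. by apply: closed_bigI => W []. Qed.

Lemma quasi_component_sub {T : topologicalType} (K : set T) (p : T) :
  closed K -> K p -> quasi_component K p `<=` K.
Proof. by move=> cK Kp y; apply; exact: relative_clopensT. Qed.

Lemma quasi_component_refl {T : topologicalType} (K : set T) (p : T) :
  quasi_component K p p.
Proof. by move=> W []. Qed.

(** Compactness: otherwise the sets [W `\` G] generate a proper filter, any
    cluster point of which lies in the quasi-component but not in [G]. *)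
Lemma relative_clopen_sub_open {T : topologicalType} (K G : set T) (p : T) :
  compact K -> closed K -> K p -> open G -> quasi_component K p `<=` G ->
  exists2 W, relative_clopens K p W & W `<=` G.
Proof.
move=> coK cK Kp oG QG; apply: contrapT => noW.
have KK := relative_clopensT K p cK Kp.
have FF : ProperFilter
    (filter_from (relative_clopens K p) (fun W => W `\` G)).
  apply: filter_from_proper.
    apply: filter_from_filter; first by exists K.
    move=> W W' cW cW'; exists (W `&` W'); first exact: relative_clopensI.
    by move=> y [[Wy W'y] nGy].
  move=> W cW; apply: contrapT => /nonemptyPn WG0.
  by apply: noW; exists W => //; rewrite -setD_eq0.
have FK : filter_from (relative_clopens K p) (fun W => W `\` G) K.
  by exists K => // y [].
have [y [Ky cly]] := coK _ FF FK.
have clyWG W : relative_clopens K p W -> (W `\` G) y.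
  move=> cW; have cWG : closed (W `\` G).
    by case: cW => _ cW _ _; apply: closedI => //; exact: open_closedC.
  by apply: cWG => N nN; apply: cly => //; exists W.
have [_ nGy] := clyWG K KK.
by apply: nGy; apply: QG => W /clyWG [].
Qed.

Lemma relative_clopens_split {T : topologicalType} (K W G H : set T) (p : T) :
  relative_clopens K p W -> open G -> open H -> G `&` H = set0 ->
  W `<=` G `|` H -> G p -> relative_clopens K p (W `\` H).
Proof.
move=> [WK cW cKW Wp] oG oH /disjoints_subset GH WGH Gp; split=> //.
- by move=> y [/WK].
- by apply: closedI => //; exact: open_closedC.
- have -> : K `\` (W `\` H) = (K `\` W) `|` (W `\` G).
    apply/seteqP; split=> y.
      move=> [Ky nWH]; have [Wy|nWy] := pselect (W y); last by left.
      by right; split=> // Gy; apply: nWH; split=> //; exact: GH.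
    move=> [[Ky nWy]|[Wy nGy]]; split=> //; first by case.
      exact: WK.
    by move=> [_ nHy]; have [] := WGH y Wy.
  by apply: closedU => //; apply: closedI => //; exact: open_closedC.
- by split=> //; exact: GH.
Qed.

(** A separation of the quasi-component extends, by normality, to disjoint open
    sets; they cover a relatively clopen [W] and cut it into two relatively
    clopen pieces, so the quasi-component lies in the piece containing [p]. *)
Lemma quasi_component_connected {T : topologicalType} (K : set T) (p : T) :
  normal_space T -> compact K -> closed K -> K p ->
  connected (quasi_component K p).
Proof.
move=> nT coK cK Kp B B0 [P oP BP] [C cC BC]; set Q := quasi_component K p.
have cQ : closed Q := quasi_component_closed K p.
have cB : closed B by rewrite BC; exact: closedI.
have cB' : closed (Q `\` B).
  have -> : Q `\` B = Q `&` ~` P.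
    rewrite BP; apply/seteqP; split=> y [Qy nBy]; split=> //.
      by move=> Py; apply: nBy.
    by case.
  by apply: closedI => //; exact: open_closedC.
have nB : set_nbhs B (~` (Q `\` B)).
  apply/set_nbhsP; exists (~` (Q `\` B)); split=> //.
    by rewrite openC.
  by move=> y By [].
have [N /set_nbhsP [G [oG BG GN]] clN] := nT B cB _ nB.
pose H := ~` closure N.
have oH : open H by rewrite openC; exact: closed_closure.
have GH : G `&` H = set0.
  by apply/disjoints_subset => y Gy; apply; apply: subset_closure; exact: GN.
have BH y : Q y -> ~ B y -> H y by move=> Qy nBy /clN; apply.
have QGH : Q `<=` G `|` H.
  move=> y Qy; have [By|nBy] := pselect (B y); first by left; exact: BG.
  by right; exact: BH.
have [W cW WGH] :=
  relative_clopen_sub_open K (G `|` H) p coK cK Kp (openU oG oH) QGH.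
have Wp : W p by case: cW.
have [Gp|Hp] := WGH p Wp.
  apply/seteqP; split=> y; first by rewrite BP => -[].
  move=> Qy; apply: contrapT => nBy.
  have [_] := Qy _ (relative_clopens_split K W G H p cW oG oH GH WGH Gp).
  by apply; exact: BH.
have [y By] := B0; have Qy : Q y by move: By; rewrite BP => -[].
rewrite setUC in WGH; rewrite setIC in GH.
have [_ []] := Qy _ (relative_clopens_split K W H G p cW oH oG GH WGH Hp).
exact: BG.
Qed.

(** The witness is the quasi-component of [p] in the complement of [V].  Were it
    disjoint from the closure of [V], so would be some relatively clopen set
    around [p], and that set would disconnect the whole space. *)
Lemma boundary_bumping {T : topologicalType} (V : set T) (p : T) :
  hausdorff_space T -> compact [set: T] -> connected [set: T] ->
  open V -> V !=set0 -> ~ V p ->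
  exists C, [/\ compact C, connected C, C p, C `<=` ~` V
    & C `&` closure V !=set0].
Proof.
move=> hT coT cnT oV [v Vv] nVp.
have cK : closed (~` V) by exact: open_closedC.
have coK : compact (~` V) by exact: (subclosed_compact cK coT).
exists (quasi_component (~` V) p); split.
- exact: (subclosed_compact (quasi_component_closed _ _) coT).
- by apply: quasi_component_connected => //; exact: compact_normal.
- exact: quasi_component_refl.
- exact: quasi_component_sub.
apply: contrapT => /nonemptyPn/disjoints_subset QV.
have oclV : open (~` closure V) by rewrite openC; exact: closed_closure.
have [W [WK cW cKW Wp] WclV] := relative_clopen_sub_open _ _ p coK cK nVp oclV QV.
(* As [W] misses the closure of [V], it is also open in the whole space. *)
have oW : open W.
  have -> : W = ~` (~` V `\` W) `&` ~` closure V.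
    apply/seteqP; split=> y.
      by move=> Wy; split; [case | exact: WclV].
    move=> [nKW nVy]; apply: contrapT => nWy; apply: nKW; split=> //.
    by move=> Vy; apply: nVy; exact: subset_closure.
  by apply: openI => //; rewrite openC.
have WT : W = [set: T].
  apply: cnT; first by exists p.
    by exists W => //; rewrite setTI.
  by exists W => //; rewrite setTI.
by apply: (WK v) => //; rewrite WT.
Qed.

(** * Continua joining points of an open set *)

Lemma continuumU {T : topologicalType} (D D' : set T) :
  continuum D -> continuum D' -> D `&` D' !=set0 -> continuum (D `|` D').
Proof.
move=> [coD cnD [x [y [Dx Dy xy]]]] [coD' cnD' _] DD'; split.
- exact: compactU.
- exact: connectedU.
- by exists x, y; split=> //; left.
Qed.

(** [E] is half of the continuum that irreducibility will force to be the whole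
    space; the last condition says that its trace on [V] is supplied by the part
    [D] lying in [U].  A point [p] outside [V] need not be in [U], and boundary
    bumping brings it there. *)
Lemma approach_through_open {T : topologicalType} (U V : set T) (b p : T) :
  hausdorff_space T -> compact [set: T] -> connected [set: T] ->
  open V -> V !=set0 -> closure V `<=` U ->
  (forall y, U y -> exists D, [/\ continuum D, D `<=` U, D y & D b]) ->
  exists D E, [/\ continuum D, D `<=` U & D b] /\
    [/\ compact E, connected E, E p, E b & E `&` V `<=` D].
Proof.
move=> hT coT cnT oV V0 VU joinU.
have [Vp|nVp] := pselect (V p).
  have [|D [ctD DU Dp Db]] := joinU p; first by apply: VU; exact: subset_closure.
  by case: (ctD) => coD cnD _; exists D, D; split; split=> // y [].
have [C [coC cnC Cp CV [z [Cz Vz]]]] :=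
  boundary_bumping V p hT coT cnT oV V0 nVp.
have [D [ctD DU Dz Db]] := joinU z (VU z Vz).
case: (ctD) => coD cnD _; exists D, (C `|` D); split; split=> //.
- exact: compactU.
- by apply: connectedU => //; exists z.
- by left.
- by right.
- by move=> y [[/CV|]].
Qed.

(** Approaching [b] from both ends of irreducibility gives a continuum that fills
    the space, hence fills a neighbourhood of [x]; near [x] it consists only of
    points of the two continua lying in [U]. *)
Lemma irreducible_join_nbhs {T : topologicalType} (U : set T) (b x : T) :
  hausdorff_space T -> compact [set: T] -> connected [set: T] ->
  irreducible T -> open U ->
  (forall y, U y -> exists D, [/\ continuum D, D `<=` U, D y & D b]) ->
  U x -> exists D, [/\ continuum D, D `<=` U, nbhs x D & D b].
Proof.
move=> hT coT cnT [p [q irr]] oU joinU Ux.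
have [N nN clNU] : exists2 N, nbhs x N & closure N `<=` U.
  by apply: (compact_regular hT coT) => //; [exact: filterT | exact: open_nbhs_nbhs].
have VU : closure N° `<=` U.
  by apply: subset_trans clNU; apply: closureS; exact: interior_subset.
have V0 : N° !=set0 by exists x.
have oV : open N° := open_interior N.
have [D [E [[ctD DU Db] [coE cnE Ep Eb EV]]]] :=
  approach_through_open U N° b p hT coT cnT oV V0 VU joinU.
have [D' [E' [[ctD' DU' Db'] [coE' cnE' Eq' Eb' EV']]]] :=
  approach_through_open U N° b q hT coT cnT oV V0 VU joinU.
have EE' : E `|` E' = [set: T].
  apply: contrapT => EE'; apply: irr; exists (E `|` E'); split=> //.
    split=> //; first by exists p; left.
      exact: compactU.
    by apply: connectedU => //; exists b.
  by move=> y [] ->; [left | right].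
exists (D `|` D'); split.
- by apply: continuumU => //; exists b.
- by move=> y [/DU|/DU'].
- apply: (filterS _ (open_nbhs_nbhs (conj oV nN))) => y Vy.
  have [Ey|Ey] : (E `|` E') y by rewrite EE'.
    by left; apply: EV.
  by right; apply: EV'.
- by left.
Qed.

Lemma rel_interior_open {T : topologicalType} (Y D : set T) (x : T) :
  open Y -> Y x -> nbhs x D -> rel_interior Y D x.
Proof.
move=> oY Yx nD; rewrite /rel_interior /interior /=.
have Yx' : Y° x by apply: open_nbhs_nbhs.
by rewrite -(nbhs_subspace_interior Yx').
Qed.

Theorem theorem5p20 (R : realType) (X : metricType R)
  (X_continuum : continuum [set: X]) (X_irreducible : irreducible X) :
  NWC1 X = CC1 X.
Proof.
case: X_continuum => coX cnX _.
have hX : hausdorff_space X by exact: metric_hausdorff.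
apply/seteqP; split=> A [hA [AT|]].
- by split; [|left].
- move=> [B [BA [b Bb] joinB]]; split; [by []|right]; subst B.
  exists [set b]; split=> //; first by exists b.
  have oA : open (~` A).
    by case: hA => _ _ coA; rewrite openC; exact: compact_closed.
  have joinb y : (~` A) y ->
      exists D, [/\ continuum D, D `<=` ~` A, D y & D b].
    by move=> /joinB [D [ctD DA Dy [_ [-> Db]]]]; exists D.
  move=> x Ax.
  have [D [ctD DA nD Db]] :=
    irreducible_join_nbhs (~` A) b x hX coX cnX X_irreducible oA joinb Ax.
  exists D; split=> //; first exact: rel_interior_open.
  by exists b.
- by split; [|left].
- move=> [B [BA Bb joinB]]; split; [by []|right]; exists B; split=> // x /joinB.
  move=> [D [ctD DA iD BD]]; exists D; split=> //.
  exact: (@interior_subset (subspace (~` A)) D x iD).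
Qed.
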